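(* Let $V$ be a set equipped with two closed binary operations $\oplus$ and $\otimes$ having identity elements $0$ and $1$ respectively (so $v\oplus 0=0\oplus v=v$ and $v\otimes 1=1\otimes v=v$ for all $v\in V$). No associativity, commutativity, distributivity, or annihilation property of $0$ is assumed. Then the following are equivalent: (i) $\oplus$ and $\otimes$ satisfy all three of the following: (a) (zero-sum-free) for all $a,b\in V$, $a\oplus b=0$ if and only if $a=b=0$; (b) (no zero divisors) for all $a,b\in V$, $a\otimes b=0$ if and only if $a=0$ or $b=0$; (c) ($0$ is an annihilator for $\otimes$) for all $a\in V$, $a\otimes 0=0\otimes a=0$. (ii) For every graph $G$ with edge set $K$, source vertex set $K_{\mathrm{out}}$ and target vertex set $K_{\mathrm{in}}$, and every source incidence array $\mathbf{E}_{\mathrm{out}}:K\times K_{\mathrm{out}}\to V$ and target incidence array $\mathbf{E}_{\mathrm{in}}:K\times K_{\mathrm{in}}\to V$ of $G$, the array product $\mathbf{E}_{\mathrm{out}}^{\sf T}\mathbf{E}_{\mathrm{in}}:K_{\mathrm{out}}\times K_{\mathrm{in}}\to V$ is an adjacency array for $G$.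
   Context: A graph $G$ here is a directed graph, possibly with multiple edges between the same pair of vertices and with self-loops. It has a finite totally ordered edge set $K$, and each edge $k\in K$ has a source vertex and a target vertex. $K_{\mathrm{out}}$ is the finite totally ordered set of vertices that are sources of edges, and $K_{\mathrm{in}}$ is the finite totally ordered set of vertices that are targets of edges. The vertex set of $G$ is $K_{\mathrm{out}}\cup K_{\mathrm{in}}$. An associative array is a map $\mathbf{A}:K_1\times K_2\to V$ with $K_1,K_2$ finite totally ordered key sets. Its transpose $\mathbf{A}^{\sf T}:K_2\times K_1\to V$ is defined by $\mathbf{A}^{\sf T}(k_2,k_1)=\mathbf{A}(k_1,k_2)$. For $\mathbf{A}:K_1\times K_3\to V$ and $\mathbf{B}:K_3\times K_2\to V$, the product $\mathbf{C}=\mathbf{A}\mathbf{B}:K_1\times K_2\to V$ is given by $\mathbf{C}(k_1,k_2)=\bigoplus_{k_3\in K_3}\mathbf{A}(k_1,k_3)\otimes\mathbf{B}(k_3,k_2)$. The iterated $\oplus$ is taken over $K_3$ in its total order with a fixed parenthesization, e.g. left to right. A source incidence array of $G$ is a map $\mathbf{E}_{\mathrm{out}}:K\times K_{\mathrm{out}}\to V$ such that $\mathbf{E}_{\mathrm{out}}(k,a)\neq 0$ if and only if edge $k$ has source $a$. A target incidence array of $G$ is a map $\mathbf{E}_{\mathrm{in}}:K\times K_{\mathrm{in}}\to V$ such that $\mathbf{E}_{\mathrm{in}}(k,a)\neq 0$ if and only if edge $k$ has target $a$. An adjacency array for $G$ is a map $\mathbf{A}:K_{\mathrm{out}}\times K_{\mathrm{in}}\to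 V$ such that $\mathbf{A}(a,b)\neq 0$ if and only if there is an edge of $G$ with source $a$ and target $b$. *)

(* Defs.v *)
From mathcomp Require Import all_boot all_order.

Set Implicit Arguments.
Unset Strict Implicit.
Unset Printing Implicit Defensive.

Definition assoc_array d1 d2 (K1 : finOrderType d1) (K2 : finOrderType d2)
  (V : Type) : Type := K1 -> K2 -> V.

Definition transpose d1 d2 (K1 : finOrderType d1) (K2 : finOrderType d2)
  (V : Type) (A : assoc_array K1 K2 V) : assoc_array K2 K1 V :=
  fun k2 k1 => A k1 k2.

(* ((x_1 + x_2) + ...) + x_n; the sum of no terms is 0 by convention. *)
Definition lsum (V : Type) (add : V -> V -> V) (zero : V) (s : seq V) : V :=
  if s is x :: s' then foldl add x s' else zero.

(* Order.enum K3 lists K3 increasingly for its order, unlike enum K3, whose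
   order is unspecified. *)
Definition array_mul (V : Type) (add mul : V -> V -> V) (zero : V)
  d1 d2 d3 (K1 : finOrderType d1) (K2 : finOrderType d2) (K3 : finOrderType d3)
  (A : assoc_array K1 K3 V) (B : assoc_array K3 K2 V) : assoc_array K1 K2 V :=
  fun k1 k2 =>
    lsum add zero [seq mul (A k1 k3) (B k3 k2) | k3 <- Order.enum K3].

(* Kout and Kin are totally ordered subsets of the vertex set, presented as
   finite ordered types with an injection into the vertices whose range is the
   set of sources, resp. targets. They may overlap, and their orders need not
   agree on the overlap. *)
Record graph : Type := Graph {
  vertex : Type;
  edge_disp : Order.disp_t;
  edge : finOrderType edge_disp;
  source : edge -> vertex;
  target : edge -> vertex;
  Kout_disp : Order.disp_t;
  Kout : finOrderType Kout_disp;
  out_vertex : Kout -> vertex;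
  out_vertex_inj : injective out_vertex;
  out_vertexP : forall v, (exists a, out_vertex a = v) <->
                          (exists k, source k = v);
  Kin_disp : Order.disp_t;
  Kin : finOrderType Kin_disp;
  in_vertex : Kin -> vertex;
  in_vertex_inj : injective in_vertex;
  in_vertexP : forall v, (exists b, in_vertex b = v) <->
                         (exists k, target k = v);
  vertexP : forall v, (exists a, out_vertex a = v) \/
                      (exists b, in_vertex b = v)
}.

Definition source_incidence (V : Type) (zero : V) (G : graph)
  (E : assoc_array (edge G) (Kout G) V) : Prop :=
  forall k a, E k a <> zero <-> source k = out_vertex a.

Definition target_incidence (V : Type) (zero : V) (G : graph)
  (E : assoc_array (edge G) (Kin G) V) : Prop :=
  forall k b, E k b <> zero <-> target k = in_vertex b.

Definition adjacency (V : Type) (zero : V) (G : graph)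
  (A : assoc_array (Kout G) (Kin G) V) : Prop :=
  forall a b, A a b <> zero <->
    exists k, source k = out_vertex a /\ target k = in_vertex b.

(* Main.v *)
(** If (i) holds, a term of the product is nonzero exactly when its edge goes
    from [a] to [b], and zero-sum-freeness transfers this to the sum.
    Conversely, three graphs suffice.  One loop forbids zero divisors.  Two
    loops at one vertex show that sums [(a * c) + (b * d)] of products of
    nonzero elements are nonzero, which is zero-sum-freeness once [c = d = 1]
    is allowed.  One loop at each of three vertices forces
    [((x * 0) + (0 * y)) + (0 * 0) = 0] for nonzero [x] and [y], hence the
    annihilation laws; if [1 = 0] this equation contradicts the two-loop one
    unless [V] is trivial. *)
Require Import Defs.
From mathcomp Require Import all_boot all_order.
From Stdlib Require Import Classical.

Set Implicit Arguments.
Unset Strict Implicit.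
Unset Printing Implicit Defensive.

Lemma lsum_map_eq0 (V : Type) (add : V -> V -> V) (zero : V) (T : eqType)
  (F : T -> V) (s : seq T) :
  (forall a b : V, add a b = zero <-> a = zero /\ b = zero) ->
  lsum add zero (map F s) = zero <-> (forall k, k \in s -> F k = zero).
Proof.
move=> zsf; case: s => [|k s] //=.
(* The accumulator [x] is arbitrary because each step of [foldl] replaces it by a partial sum. *)
have foldl_eq0 (x : V) : foldl add x (map F s) = zero <->
    x = zero /\ (forall j, j \in s -> F j = zero).
  elim: s x => [|i s IHs] x /=; first by split=> [->|[]].
  rewrite IHs zsf; split=> [[[-> Fi0] Fs0]|[-> Fis0]].
    by split=> // j; rewrite inE => /predU1P[->|/Fs0].
  by do !split=> [|//]; [apply: Fis0; exact: mem_head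
                   | move=> j sj; apply: Fis0; rewrite inE sj orbT].
rewrite foldl_eq0; split=> [[Fk0 Fs0] j|Fks0].
  by rewrite inE => /predU1P[->|/Fs0].
by split=> [|j sj]; apply: Fks0; rewrite inE ?eqxx ?sj ?orbT.
Qed.

Fact loop_graph_keyP (K : Type) (L : Type) (f : K -> L) :
  (forall a, exists k, f k = a) ->
  forall v, (exists a : L, a = v) <-> (exists k, f k = v).
Proof. by move=> f_surj v; split=> _; [exact: f_surj | exists v]. Qed.

Fact loop_graph_vertexP (L : Type) (v : L) :
  (exists a : L, a = v) \/ (exists b : L, b = v).
Proof. by left; exists v. Qed.

(** One family covers all the test graphs: every edge is a loop, and surjectivity of [f] lets [L]
    serve at once as vertex set, [Kout] and [Kin]. *)
Definition loop_graph (dK dL : Order.disp_t) (K : finOrderType dK)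
  (L : finOrderType dL) (f : K -> L) (f_surj : forall a, exists k, f k = a) :
  graph :=
  @Graph L dK K f f dL L id (@inj_id L) (loop_graph_keyP f_surj)
         dL L id (@inj_id L) (loop_graph_keyP f_surj) (@loop_graph_vertexP L).

Definition loop_incidence (V K : Type) (L : eqType) (zero : V) (f : K -> L)
  (x : K -> V) : K -> L -> V := fun k a => if f k == a then x k else zero.

Lemma loop_incidence_neq0 (V K : Type) (L : eqType) (zero : V) (f : K -> L)
  (x : K -> V) :
  (forall k, x k <> zero) ->
  forall k a, loop_incidence zero f x k a <> zero <-> f k = a.
Proof. by move=> x_neq0 k a; rewrite /loop_incidence; case: eqP. Qed.

Definition products_are_adjacency (V : Type) (add mul : V -> V -> V)
  (zero : V) : Prop :=
  forall (G : graph) (Eout : assoc_array (edge G) (Kout G) V)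
         (Ein : assoc_array (edge G) (Kin G) V),
    source_incidence zero Eout -> target_incidence zero Ein ->
    adjacency zero (array_mul add mul zero (transpose Eout) Ein).

Section ProductsAreAdjacency.

Context (V : Type) (add mul : V -> V -> V) (zero : V).
Context (prodP : products_are_adjacency add mul zero).

(** Passing from [Order.enum] to [enum] on ordinals lets [enum_ordSl] unfold the product into an
    explicit sum. *)
Lemma loop_product_neq0 n m (f : 'I_n -> 'I_m) (x y : 'I_n -> V) a b :
  (forall a, exists k, f k = a) ->
  (forall k, x k <> zero) -> (forall k, y k <> zero) ->
  lsum add zero [seq mul (loop_incidence zero f x k a)
                         (loop_incidence zero f y k b) | k <- enum 'I_n]
    <> zero <-> exists k, f k = a /\ f k = b.
Proof.
move=> f_surj x_neq0 y_neq0; rewrite -Order.enum_ord.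
exact: (@prodP (loop_graph f_surj) (loop_incidence zero f x)
  (loop_incidence zero f y) (loop_incidence_neq0 f x_neq0)
  (loop_incidence_neq0 f y_neq0)).
Qed.

Lemma mul_neq0 a b : a <> zero -> b <> zero -> mul a b <> zero.
Proof.
move=> a_neq0 b_neq0.
have [] := @loop_product_neq0 1 1 id (fun=> a) (fun=> b) ord0 ord0.
- by move=> k; exists k.
- by [].
- by [].
rewrite enum_ordSl enum_ord0 /loop_incidence /= => _; apply.
by exists ord0.
Qed.

Lemma add_mul_neq0 a b c d :
  a <> zero -> b <> zero -> c <> zero -> d <> zero ->
  add (mul a c) (mul b d) <> zero.
Proof.
move=> a_neq0 b_neq0 c_neq0 d_neq0.
have [] := @loop_product_neq0 2 1 (fun=> ord0)
  (fun k => if k == ord0 then a else b) (fun k => if k == ord0 then c else d)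
  ord0 ord0.
- by move=> k; exists ord0; rewrite [k]ord1.
- by move=> k; case: eqP.
- by move=> k; case: eqP.
rewrite !enum_ordSl enum_ord0 /loop_incidence /= => _; apply.
by exists ord0.
Qed.

(** No loop joins vertex 0 to vertex 1, so this entry vanishes. The loops at 0 and 1 contribute
    [mul a zero] and [mul zero b]; the third loop, away from both vertices, contributes
    [mul zero zero]. *)
Lemma off_diagonal_eq0 a b : a <> zero -> b <> zero ->
  add (add (mul a zero) (mul zero b)) (mul zero zero) = zero.
Proof.
move=> a_neq0 b_neq0; apply: NNPP.
pose i1 : 'I_3 := lift ord0 ord0.
have [] := @loop_product_neq0 3 3 id (fun=> a) (fun=> b) ord0 i1.
- by move=> k; exists k.
- by [].
- by [].
rewrite !enum_ordSl enum_ord0 /loop_incidence /= => nz _ /nz[k [->]].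
by [].
Qed.

End ProductsAreAdjacency.

Theorem theorem1 (V : Type) (add mul : V -> V -> V) (zero one : V)
  (add0v : forall v : V, add zero v = v)
  (addv0 : forall v : V, add v zero = v)
  (mul1v : forall v : V, mul one v = v)
  (mulv1 : forall v : V, mul v one = v) :
  ((forall a b : V, add a b = zero <-> a = zero /\ b = zero) /\
   (forall a b : V, mul a b = zero <-> a = zero \/ b = zero) /\
   (forall a : V, mul a zero = zero /\ mul zero a = zero))
  <->
  (forall (G : graph)
          (Eout : assoc_array (edge G) (Kout G) V)
          (Ein : assoc_array (edge G) (Kin G) V),
     source_incidence zero Eout ->
     target_incidence zero Ein ->
     adjacency zero (array_mul add mul zero (transpose Eout) Ein)).
Proof.
split=> [[zsf [nzd _]] G Eout Ein EoutP EinP a b|prodP].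
  rewrite /array_mul lsum_map_eq0 //; split=> [sum_neq0|[k [ka kb]] sum_eq0].
    apply: NNPP => no_edge; apply: sum_neq0 => k _; apply: NNPP => term_neq0.
    apply: no_edge; exists k; rewrite -(EoutP k a) -(EinP k b).
    (* A zero factor would make the term zero. *)
    by split=> E0; apply: term_neq0; rewrite nzd; [left | right].
  have := sum_eq0 k; rewrite Order.mem_enum => /(_ isT) /nzd.
  by case; [apply/EoutP | apply/EinP].
(* Incidence entries on an edge are nonzero, so [one] can be such an entry only when it differs from
   [zero]. *)
have [one_eq0|one_neq0] := classic (one = zero).
  have V0 v : v = zero.
    apply: NNPP => v_neq0.
    (* Taking [mul v v] instead of [v] makes the entry collapse to [add (mul v v) (mul v v)], a sum
       of the form that [add_mul_neq0] excludes. *)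
    have := off_diagonal_eq0 prodP (mul_neq0 prodP v_neq0 v_neq0)
                                   (mul_neq0 prodP v_neq0 v_neq0).
    rewrite -one_eq0 !mul1v !mulv1 one_eq0 addv0.
    exact: (add_mul_neq0 prodP).
  by do !split=> *; rewrite ?[LHS]V0; do ?[left]; exact: V0.
have zsf a b : add a b = zero <-> a = zero /\ b = zero.
  split=> [ab0|[-> ->] //].
  have [a0|a_neq0] := classic (a = zero); first by move: ab0; rewrite a0 add0v.
  have [b0|b_neq0] := classic (b = zero); first by move: ab0; rewrite b0 addv0.
  have := add_mul_neq0 prodP a_neq0 b_neq0 one_neq0 one_neq0.
  by rewrite !mulv1.
(* The third loop yields [mul zero zero = zero], which settles the case [a = zero] of [ann]. *)
have /zsf[_ mul00] := off_diagonal_eq0 prodP one_neq0 one_neq0.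
have ann a : mul a zero = zero /\ mul zero a = zero.
  have [->|a_neq0] := classic (a = zero); first by [].
  by have /zsf[/zsf] := off_diagonal_eq0 prodP a_neq0 a_neq0.
split=> //; split=> // a b.
split=> [ab0|[] ->]; [|by have [] := ann b|by have [] := ann a].
apply: NNPP => /not_or_and[a_neq0 b_neq0].
exact: (mul_neq0 prodP) ab0.
Qed.
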